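(* Let $L,R:[0,\infty)\times\mathbb{R}\to\mathbb{R}$ satisfy: (i) for each $x\in\mathbb{R}$, $L(\cdot,x),R(\cdot,x)\in D[0,\infty)$; (ii) for each $t\ge 0$, $L(t,\cdot)$ and $R(t,\cdot)$ are strictly increasing; (iii) there are constants $0<c<C<\infty$ such that $c|x-y|\le |L(t,x)-L(t,y)|\le C|x-y|$ and $c|x-y|\le |R(t,x)-R(t,y)|\le C|x-y|$ for all $t\ge 0$, $x,y\in\mathbb{R}$; (iv) $\inf_{(t,x)\in[0,\infty)\times\mathbb{R}}(R(t,x)-L(t,x))>0$. Let $S\in D[0,\infty)$ and $d\ge 0$. If $(X,K)$ solves the Skorokhod problem $\mathbb{SP}_L^R(S)$, then $(H_d(X),T_d(K))$ solves the Skorokhod problem $\mathbb{SP}_{L^d}^{R^d}(T_d(S)+X_d)$, where $(T_d(\psi))_t=\psi_{d+t}-\psi_d$ and $(H_d(\psi))_t=\psi_{d+t}$ for $\psi\in D[0,\infty)$, $t\ge0$, and $L^d(t,x)=L(t+d,x)$, $R^d(t,x)=R(t+d,x)$.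
   Context: $D[0,\infty)$ is the set of real-valued right-continuous functions on $[0,\infty)$ with left limits; $BV[0,\infty)$ is the set of $K\in D[0,\infty)$ of bounded variation on each compact interval. Skorokhod problem $\mathbb{SP}_L^R(S)$: a pair $(X,K)\in D[0,\infty)\times BV[0,\infty)$ is a solution if (a) $X_t=S_t+K_t$ for all $t\ge0$; (b) $L(t,X_t)\le 0\le R(t,X_t)$ for all $t\ge 0$; (c) $K_{0-}=0$ and $K=K^r-K^l$, where $K^r,K^l$ are nondecreasing (right-continuous, with $K^r_{0-}=K^l_{0-}=0$) and $\int_0^\infty I_{\{L(s,X_s)<0\}}dK^l_s=0$, $\int_0^\infty I_{\{R(s,X_s)>0\}}dK^r_s=0$. The integrals are over $[0,\infty)$ including time $0$, where $dK^r,dK^l$ have atoms of mass $K^r_0,K^l_0$. *)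

(* Defs.v *)
From mathcomp Require Export all_boot all_order all_algebra.
From mathcomp Require Export all_classical all_reals all_analysis.
Export Order.TTheory GRing.Theory Num.Theory.
Export numFieldNormedType.Exports.

Set Implicit Arguments.
Unset Strict Implicit.
Unset Printing Implicit Defensive.

Local Open Scope classical_set_scope.
Local Open Scope ring_scope.

(* A function on [0, oo) is represented by a total function R -> R of which
   only the values at arguments t >= 0 are ever used. *)

Section skorokhod_problem.
Context {R : realType}.
Implicit Types (f K X S : R -> R) (L U : R -> R -> R).

(* D[0, oo); there is no left limit to require at 0. *)
Definition cadlag f : Prop :=
  (forall t : R, 0 <= t -> f x @[x --> t^'+] --> f t) /\
  (forall t : R, 0 < t -> cvg (f x @[x --> t^'-])).

(* BV[0, oo); every compact interval of [0, oo) is contained in some [0, T]. *)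
Definition cadlag_bv f : Prop :=
  cadlag f /\ (forall T : R, 0 <= T -> bounded_variation 0 T f).

(* Unlike other functions of time, Kr and Kl live on the whole line and vanish
   on (-oo, 0): this is the convention Kr_{0-} = Kl_{0-} = K_{0-} = 0, and it
   gives the Stieltjes measures dKr and dKl the atoms Kr_0 and Kl_0 at 0.
   The upper barrier is written U. *)
Definition skorokhod_solution L U S X K : Prop :=
  [/\ cadlag X,
      cadlag_bv K,
      forall t : R, 0 <= t -> X t = S t + K t,
      forall t : R, 0 <= t -> L t (X t) <= 0 <= U t (X t)
    & exists Kr Kl : cumulative R R,
      [/\ forall t : R, t < 0 -> Kr t = 0 /\ Kl t = 0,
          forall t : R, 0 <= t -> K t = Kr t - Kl t,
          (\int[lebesgue_stieltjes_measure Kl]_(s in `[(0 : R)%R, +oo[)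
             (\1_[set u | (L u (X u) < 0)%R] s)%:E = 0)%E
        & (\int[lebesgue_stieltjes_measure Kr]_(s in `[(0 : R)%R, +oo[)
             (\1_[set u | (0 < U u (X u))%R] s)%:E = 0)%E]].

Definition Hshift (d : R) (psi : R -> R) : R -> R := fun t => psi (d + t).

Definition Tshift (d : R) (psi : R -> R) : R -> R :=
  fun t => psi (d + t) - psi d.

Definition barrier_shift (d : R) L : R -> R -> R := fun t x => L (t + d) x.

End skorokhod_problem.

(* Main.v *)
From HB Require Import structures.
From mathcomp Require Import measurable_realfun ring.
Require Import Defs.

(* A solution restarted at time d is driven by the measures dK^r and dK^l
   restricted to the open half-line (d, +oo) and translated by -d: restarting
   at 0 the increments of K^r and K^l after d forgets their mass at d.  These
   measures still give no mass to the times where a barrier is not touched. *)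

Local Open Scope classical_set_scope.
Local Open Scope ring_scope.

Section right_left_limits_of_translates.
Context {R : realType}.
Implicit Types (d t : R) (f : R -> R).

(** Both filters are images of the right neighbourhoods of 0. As an equality of filters, it turns a
    limit of [f (d + x)] at [t] into a limit of [f] at [d + t] by rewriting. *)
Lemma at_right_addl d t : +%R d @ t^'+ = (d + t)^'+.
Proof.
apply/funext => P; apply/propext.
have -> : (+%R d @ t^'+) P = \forall x \near t^'+, P (d + x) by [].
have -> : (d + t)^'+ P = \forall x \near (d + t)^'+, P x by [].
rewrite (propext (nbhs_right0P _ _)) (propext (nbhs_right0P (d + t) _)).
by under eq_near do rewrite addrA.
Qed.

Lemma at_left_addl d t : +%R d @ t^'- = (d + t)^'-.
Proof.
apply/funext => P; apply/propext.
have -> : (+%R d @ t^'-) P = \forall x \near t^'-, P (d + x) by [].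
have -> : (d + t)^'- P = \forall x \near (d + t)^'-, P x by [].
rewrite (propext (nbhs_left0P _ _)) (propext (nbhs_left0P (d + t) _)).
by under eq_near do rewrite addrA.
Qed.

Lemma cadlag_Hshift d f : 0 <= d -> cadlag f -> cadlag (Hshift d f).
Proof.
move=> d0 [rcf llf]; split=> t t0.
  have := rcf _ (addr_ge0 d0 t0).
  by rewrite -at_right_addl.
have := llf _ (ltr_wpDl d0 t0).
by rewrite -at_left_addl.
Qed.

Lemma cadlag_subr_cst f (c : R) : cadlag f -> cadlag (fun t => f t - c).
Proof.
move=> [rcf llf]; split=> t t0.
  by apply: cvgB; [exact: rcf | exact: cvg_cst].
by apply: is_cvgB; [exact: llf | exact: is_cvg_cst].
Qed.

End right_left_limits_of_translates.

Section bounded_variation_translate.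
Context {R : realType}.
Implicit Types (a b c d : R) (f : R -> R).

Lemma itv_partition_addl d a b (s : seq R) :
  itv_partition a b s -> itv_partition (d + a) (d + b) (map (+%R d) s).
Proof.
move=> [pas /eqP <-]; split; last by rewrite last_map.
by rewrite path_map; apply: sub_path pas => x y /= xy; rewrite ltrD2l.
Qed.

Lemma variation_addl d a b f (s : seq R) :
  variation a b (fun t => f (d + t)) s =
  variation (d + a) (d + b) f (map (+%R d) s).
Proof.
rewrite /variation size_map; apply: eq_big_nat => i /andP[_ ilt].
(* [variation] reads its points by [nth] with the right endpoint as default; both indices are in
   range, so the change of default is harmless. *)
rewrite /= -(map_cons (+%R d)) !(nth_map b)//.
by rewrite ltnW.
Qed.

Lemma bounded_variation_addl d a b f :
  bounded_variation (d + a) (d + b) f ->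
  bounded_variation a b (fun t => f (d + t)).
Proof.
move=> [M Mub]; exists M => _ [s abs <-].
by rewrite variation_addl; apply/Mub/variations_variation/itv_partition_addl.
Qed.

Lemma bounded_variation_subr_cst a b f c :
  bounded_variation a b f -> bounded_variation a b (fun t => f t - c).
Proof.
move=> [M Mub]; exists M => _ [s abs <-].
rewrite [leLHS](_ : _ = variation a b f s); first exact/Mub/variations_variation.
by apply: eq_big_nat => i _ /=; rewrite opprB addrA subrK.
Qed.

End bounded_variation_translate.

Lemma cadlag_bv_Tshift (R : realType) (d : R) (K : R -> R) :
  0 <= d -> cadlag_bv K -> cadlag_bv (Tshift d K).
Proof.
move=> d0 [cK bK]; split; first exact/cadlag_subr_cst/cadlag_Hshift.
move=> T T0; apply/bounded_variation_subr_cst/bounded_variation_addl.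
have dT : d <= d + T by rewrite lerDl.
by apply: (@bounded_variationr _ 0); rewrite ?addr0//; exact/bK/addr_ge0.
Qed.

Section cumulative_restart.
Context {R : realType}.
Implicit Types (d t : R) (F : cumulative R R).

(** The truncation [Num.max t 0] extends the increments of [F] after [d] by 0 to negative times. The
    value at 0 is 0 as well, so the associated measure has no atom there. *)
Definition restart d F : R -> R := fun t => F (d + Num.max t 0) - F d.

Let restart_nondecreasing d F : nondecreasing (restart d F).
Proof.
move=> s t st; rewrite /restart lerD2r.
apply: cumulative_is_nondecreasing; rewrite lerD2l.
by rewrite ge_max !le_max st lexx/= orbT.
Qed.

Let restart_right_continuous d F : right_continuous (restart d F).
Proof.
move=> t; rewrite /restart; apply: cvgB; last exact: cvg_cst.
(* If [0 <= t], the truncation is inactive to the right of [t]; if [t < 0], the truncated function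
   is constant near [t]. *)
have [t0|t0] := leP 0 t.
  have Fdt : F (d + x) @[x --> t^'+] --> F (d + t).
    by have := cumulative_is_right_continuous F (d + t); rewrite -at_right_addl.
  apply: cvg_trans Fdt; apply: near_eq_cvg; near=> x.
  rewrite max_l//; apply: le_trans t0 _; apply: ltW.
  by near: x; exact: nbhs_right_gt.
have Fd0 : F (d + 0) @[_ --> t^'+] --> F (d + 0) by exact: cvg_cst.
apply: cvg_trans Fd0; apply: near_eq_cvg; near=> x.
rewrite max_r//; apply: ltW; near: x; exact: nbhs_right_lt.
Unshelve. all: by end_near. Qed.

HB.instance Definition _ d F := isCumulative.Build R _ R (restart d F)
  (@restart_nondecreasing d F) (@restart_right_continuous d F).

Lemma restart_lt0 d F t : t < 0 -> restart d F t = 0.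
Proof. by move=> t0; rewrite /restart max_r ?(ltW t0)// addr0 subrr. Qed.

Lemma restart_ge0 d F t : 0 <= t -> restart d F t = F (d + t) - F d.
Proof. by move=> t0; rewrite /restart max_l. Qed.

Lemma lebesgue_stieltjes_measure_itvoc F (a b : R) : a <= b ->
  lebesgue_stieltjes_measure F `]a, b] = (F b - F a)%:E.
Proof.
move=> ab; rewrite /lebesgue_stieltjes_measure /measure_extension.
by rewrite measurable_mu_extE/= ?wlength_itv_bnd//; exact: is_ocitv.
Qed.

(** The right-hand side is a measure in [A], namely a restriction pushed forward by a translation.
    By uniqueness of Lebesgue-Stieltjes measures it suffices to compare on the intervals []a,
    b]]. *)
Lemma lebesgue_stieltjes_measure_restart d F (A : set (measurableTypeR R)) :
  measurable A ->
  lebesgue_stieltjes_measure (restart d F) A =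
  lebesgue_stieltjes_measure F
    (((fun x => x - d) @^-1` A) `&` `]d, +oo[).
Proof.
have mD : measurable (`]d, +oo[ : set (measurableTypeR R)).
  exact: measurable_itv.
have mf : measurable_fun [set: measurableTypeR R]
    ((fun x => x - d) : measurableTypeR R -> measurableTypeR R).
  exact: measurable_funB.
apply: (@lebesgue_stieltjes_measure_unique _ (restart d F)
  (pushforward (mrestr (lebesgue_stieltjes_measure F) mD)
     ((fun x => x - d) : measurableTypeR R -> measurableTypeR R))).
move=> _ [[a b]] _ <- /=; rewrite /pushforward /mrestr.
have [ab|ba] := leP a b; last first.
  by rewrite set_itv_ge ?bnd_simp -?leNgt ?(ltW ba)// preimage_set0 set0I !measure0.
(* Cutting []d + a, d + b]] at [d] truncates [a] and [b] at 0, and the new endpoints are exactly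
   where [restart d F] evaluates [F]. For [b <= 0] both sides are empty. *)
have -> : ((fun x => x - d) @^-1` `]a, b]) `&` `]d, +oo[ =
    `]d + Num.max a 0, d + Num.max b 0]%classic.
  apply/seteqP; split=> x /=; rewrite !in_itv/= !andbT.
    move=> [/andP[ax xb] dx]; rewrite -ltrBrDl -lerBlDl gt_max le_max.
    by rewrite ax subr_gt0 dx xb.
  rewrite -ltrBrDl -lerBlDl gt_max le_max subr_gt0.
  move=> /andP[/andP[-> dx] /orP[->//|]].
  by rewrite subr_le0 leNgt dx.
have ab0 : d + Num.max a 0 <= d + Num.max b 0.
  by rewrite lerD2l ge_max !le_max ab lexx/= orbT.
rewrite !lebesgue_stieltjes_measure_itvoc// /restart/=; congr _%:E.
by rewrite opprB addrA subrK.
Qed.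

End cumulative_restart.

Section integral_indic_null.
Import HBNNSimple.
Local Open Scope ereal_scope.
Context d (T : measurableType d) (R : realType).
Variable mu : {measure set T -> \bar R}.

(* N need not be measurable: the integral is a supremum over the simple
   functions below the indicator, hence an inner measure. *)
Lemma integral_indic_eq0P (D N : set T) :
  \int[mu]_(x in D) (\1_N x)%:E = 0 <->
  forall A, measurable A -> A `<=` D `&` N -> mu A = 0.
Proof.
rewrite ge0_integralE//; split=> [int0 A mA ADN|null].
  (* The indicator of [A] is one of the simple functions in the supremum, with integral [mu A]. *)
  apply/eqP; rewrite eq_le measure_ge0 andbT -int0 -(sintegral_indic mu A).
  apply: ereal_sup_ubound; exists (indic_nnsfun R mA) => //= x.
  rewrite -[mindic R mA x]/(\1_A x) /patch !indicE; case: (boolP (x \in A)) => xA; last first.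
    by case: ifPn => // _; rewrite lee_fin.
  by have [/mem_set -> /mem_set Nx] := ADN _ (set_mem xA); rewrite Nx.
apply/eqP; rewrite eq_le; apply/andP; split; last first.
  apply: ereal_sup_ubound; exists nnsfun0; last exact: sintegral0.
  by move=> x /=; rewrite /patch; case: ifPn => // _; rewrite lee_fin indicE ler0n.
(* The level set of [h] at a value [r != 0] is measurable and contained in both [D] and [N], hence
   null, so every term of the integral of [h] vanishes. *)
apply: ge_ereal_sup => _ [h hN <-]; rewrite sintegralE fsbig1// => r _.
have [->|r0] := eqVneq r 0%R; first by rewrite mul0e.
rewrite null ?mule0// => x /= hx.
have r_gt0 : (0 < r)%R by rewrite lt_neqAle eq_sym r0 -hx/= fun_ge0.
have := hN x; rewrite hx /patch; case: ifPn => [xD|_]; last first.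
  by rewrite leNgt lte_fin r_gt0.
rewrite indicE; case: (boolP (x \in N)) => xN; first by split; exact/set_mem.
by rewrite lee_fin leNgt r_gt0.
Qed.

End integral_indic_null.

(** A measurable set of times [s >= 0] with [N (d + s)], translated by [d] and cut to []d, +oo[],
    lies in [N] and, as [0 <= d], in the half-line from 0; so [dF] does not charge it. *)
Lemma integral_restart_null (R : realType) (d : R) (F : cumulative R R)
    (N : set (measurableTypeR R)) : 0 <= d ->
  (\int[lebesgue_stieltjes_measure F]_(s in `[(0 : R)%R, +oo[) (\1_N s)%:E = 0)%E ->
  (\int[lebesgue_stieltjes_measure (restart d F)]_(s in `[(0 : R)%R, +oo[)
     (\1_[set u : measurableTypeR R | N (d + u)] s)%:E = 0)%E.
Proof.
move=> d0 /integral_indic_eq0P nullN; apply/integral_indic_eq0P => A mA AN.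
rewrite [LHS](lebesgue_stieltjes_measure_restart d F A mA); apply: nullN.
  apply: measurableI; last exact: measurable_itv.
  rewrite -[X in measurable X]setTI.
  have mB : measurable_fun [set: measurableTypeR R]
      ((fun x => x - d) : measurableTypeR R -> measurableTypeR R).
    exact: measurable_funB.
  exact: mB.
move=> x [/= /AN[_ /=]]; rewrite addrC subrK !in_itv/= !andbT => Nx dx.
by split=> //; exact: le_trans (ltW dx).
Qed.

Theorem theorem3p1 (R : realType) (L U : R -> R -> R)
  (cadlagL : forall x : R, cadlag (fun t => L t x))
  (cadlagU : forall x : R, cadlag (fun t => U t x))
  (incrL : forall t : R, 0 <= t -> {homo L t : x y / x < y})
  (incrU : forall t : R, 0 <= t -> {homo U t : x y / x < y})
  (bilipschitz : exists c C : R, 0 < c < C /\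
    forall t x y : R, 0 <= t ->
      c * `|x - y| <= `|L t x - L t y| <= C * `|x - y| /\
      c * `|x - y| <= `|U t x - U t y| <= C * `|x - y|)
  (gap : (0 < ereal_inf
    [set (U p.1 p.2 - L p.1 p.2)%:E | p in `[(0 : R)%R, +oo[ `*` [set: R]])%E)
  (S X K : R -> R) (d : R)
  (cadlagS : cadlag S) (d_ge0 : 0 <= d)
  (solXK : skorokhod_solution L U S X K) :
  skorokhod_solution (barrier_shift d L) (barrier_shift d U)
    (Tshift d S \+ cst (X d)) (Hshift d X) (Tshift d K).
Proof.
have [cX bvK XSK LU [Kr [Kl [_ KE nullL nullU]]]] := solXK.
split.
- exact: cadlag_Hshift.
- exact: cadlag_bv_Tshift.
(* The equation is used at [d + t] and at [d]: the added constant [X d] equals [S d + K d] and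
   cancels what the two shifts subtract. *)
- move=> t t0; rewrite /Hshift /Tshift /= !XSK ?addr_ge0//; ring.
- by move=> t t0; rewrite /barrier_shift addrC LU ?addr_ge0.
exists (restart d Kr), (restart d Kl); split.
- by move=> t t0; rewrite /= !restart_lt0.
- move=> t t0; rewrite /Tshift !KE ?addr_ge0//= !restart_ge0//; ring.
(* The times at which the restarted path is off a barrier are the original such times moved back by
   [d]; only [u + d] against [d + u] has to be reconciled. *)
- have -> : [set u | barrier_shift d L u (Hshift d X u) < 0] =
      [set u | [set v | L v (X v) < 0] (d + u)].
    by apply/seteqP; split=> u /=; rewrite /barrier_shift (addrC u).
  exact: integral_restart_null.
- have -> : [set u | 0 < barrier_shift d U u (Hshift d X u)] =
      [set u | [set v | 0 < U v (X v)] (d + u)].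
    by apply/seteqP; split=> u /=; rewrite /barrier_shift (addrC u).
  exact: integral_restart_null.
Qed.
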